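(* Let $\mathcal{V}$ be a vector space over a field $\mathbb{F}$, let $\mathcal{D}:\mathcal{V}\to\mathcal{V}$ be a non-trivial linear endomorphism, and let $$P=(\mathcal{D}+\lambda_0)^{p_0}(\mathcal{D}+\lambda_1)^{p_1}\cdots(\mathcal{D}+\lambda_\ell)^{p_\ell}:\mathcal{V}\to\mathcal{V},$$ with $\lambda_0,\ldots,\lambda_\ell\in\mathbb{F}$ mutually distinct and $p_i\in\mathbb{Z}_{\ge1}$ for $i=0,\ldots,\ell$. Fix $f\in\mathcal{V}$. Then there is a 1-1 relationship (bijection) between solutions $u\in\mathcal{V}$ of $Pu=f$ and solutions $(u_0,\ldots,u_\ell)\in\bigoplus^{\ell+1}\mathcal{V}$ of the problem $$(\mathcal{D}+\lambda_0)^{p_0}u_0=f,\ \ldots,\ (\mathcal{D}+\lambda_\ell)^{p_\ell}u_\ell=f.$$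
   Context: Products of operators are compositions, and scalars act as multiples of the identity. *)

(* Defs.v *)
From HB Require Import structures.
From mathcomp Require Import all_boot all_order all_algebra.

Set Implicit Arguments.
Unset Strict Implicit.
Unset Printing Implicit Defensive.

Import GRing.Theory.
Local Open Scope ring_scope.

Section Operators.
Variables (F : fieldType) (V : lmodType F) (D : {linear V -> V}).

Definition shift_op (a : F) : V -> V := D \+ a \*: idfun.

Definition factor_op (a : F) (k : nat) : V -> V := iter k (shift_op a).

(* The leftmost factor (index 0) is applied last. *)
Definition product_op (l : nat) (lam : 'I_l.+1 -> F) (p : 'I_l.+1 -> nat) :
    V -> V :=
  \big[@comp V V V/idfun]_(i < l.+1) factor_op (lam i) (p i).

Definition product_sol (l : nat) (lam : 'I_l.+1 -> F) (p : 'I_l.+1 -> nat)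
    (f : V) : pred V :=
  fun u => product_op lam p u == f.

(* Finite direct sum of l + 1 copies of V, as families indexed by 'I_l.+1. *)
Definition system_sol (l : nat) (lam : 'I_l.+1 -> F) (p : 'I_l.+1 -> nat)
    (f : V) : pred {ffun 'I_l.+1 -> V} :=
  fun us => [forall i, factor_op (lam i) (p i) (us i) == f].

End Operators.

(* Main.v *)
Require Import Defs.
From HB Require Import structures.
From mathcomp Require Import all_boot all_order all_algebra.

(** Let [F[X]] act on [V] through [D], [X] acting as [D].  With
    [P_i = (X + lam_i)^p_i] and [Q_i] the product of the [P_j], [j != i],
    the equation reads [P u = f] where [P = P_i Q_i] for every [i].  A solution
    [u] yields the solutions [u_i = Q_i u] of [P_i u_i = f].  As the [lam_i]
    are distinct, the [P_i] are pairwise coprime, so the [Q_i] generate the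
    unit ideal: [sum_i c_i Q_i = 1] ([exists_partition_of_unity]).  The inverse
    map is then [(u_i) |-> sum_i c_i u_i].

    One composite is the identity by the Bezout relation itself.  The other one
    also uses that [Q_i u_j = Q_j u_i] for solutions of the system: for
    [i != j] both are the image of [f] under the product of the [P_k],
    [k != i, j] ([cofactor_exchange]).  Hence
    [Q_i (sum_j c_j u_j) = sum_j c_j Q_j u_i = u_i].  The Bezout relation
    also gives [P (sum_i c_i u_i) = sum_i c_i Q_i f = f], so one side has a
    solution exactly when the other has. *)

Set Implicit Arguments.
Unset Strict Implicit.
Unset Printing Implicit Defensive.

Import GRing.Theory.
Local Open Scope ring_scope.

Section PolynomialAction.
Variables (F : fieldType) (V : lmodType F) (D : {linear V -> V}).
Implicit Types (q r : {poly F}) (v : V).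

(** The [F[X]]-module structure on [V] for which [X] acts as [D]. *)
Definition poly_act q v : V := \sum_(i < size q) q`_i *: iter i D v.

(** The summation bound may be any bound on the size, which makes the action
    of a sum comparable with the actions of its terms. *)
Lemma poly_act_wide n q v : (size q <= n)%N ->
  poly_act q v = \sum_(i < n) q`_i *: iter i D v.
Proof.
move=> le_qn; rewrite /poly_act (big_ord_widen n (fun i => q`_i *: iter i D v)) //.
rewrite big_mkcond; apply: eq_bigr => i _; case: ltnP => // le_qi.
by rewrite nth_default // scale0r.
Qed.

Lemma iter_is_linear n : linear (iter n D).
Proof. by elim: n => [|n IHn] a u v /=; rewrite ?IHn ?linearP. Qed.

Lemma poly_act_is_linear q : linear (poly_act q).
Proof.
move=> a u v; rewrite /poly_act scaler_sumr -big_split; apply: eq_bigr => i _ /=.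
by rewrite iter_is_linear scalerDr !scalerA mulrC.
Qed.

HB.instance Definition _ q :=
  GRing.isLinear.Build F V V _ (poly_act q) (poly_act_is_linear q).

Lemma poly_actD q r v : poly_act (q + r) v = poly_act q v + poly_act r v.
Proof.
pose n := maxn (size q) (size r).
rewrite (@poly_act_wide n) ?size_polyD // (@poly_act_wide n q) ?leq_maxl //.
rewrite (@poly_act_wide n r) ?leq_maxr // -big_split.
by apply: eq_bigr => i _; rewrite coefD scalerDl.
Qed.

Lemma poly_actC a v : poly_act a%:P v = a *: v.
Proof.
by rewrite (@poly_act_wide 1) ?size_polyC_leq1 // big_ord1 coefC.
Qed.

Lemma poly_actZ a q v : poly_act (a *: q) v = a *: poly_act q v.
Proof.
rewrite (@poly_act_wide (size q)) ?size_scale_leq // scaler_sumr.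
by apply: eq_bigr => i _; rewrite coefZ scalerA.
Qed.

Lemma poly_act1 v : poly_act 1 v = v.
Proof. by rewrite poly_actC scale1r. Qed.

Lemma poly_actMX q v : poly_act (q * 'X) v = poly_act q (D v).
Proof.
rewrite (@poly_act_wide (size q).+1); last first.
  by rewrite (leq_trans (size_polyMleq _ _)) // size_polyX addn2.
rewrite big_ord_recl coefMX scale0r add0r; apply: eq_bigr => i _.
by rewrite coefMX -iterSr.
Qed.

Lemma poly_actX v : poly_act 'X v = D v.
Proof. by rewrite -['X]mul1r poly_actMX poly_act1. Qed.

Lemma poly_act_D q v : poly_act q (D v) = D (poly_act q v).
Proof.
rewrite /poly_act linear_sum; apply: eq_bigr => i _.
by rewrite linearZ /= -iterSr.
Qed.

Lemma poly_actM q r v : poly_act (q * r) v = poly_act q (poly_act r v).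
Proof.
elim/poly_ind: q v => [|q a IHq] v.
  by rewrite mul0r -polyC0 !poly_actC !scale0r.
rewrite mulrDl !poly_actD -mulrA ['X * r]mulrC mulrA !poly_actMX IHq.
by rewrite mul_polyC poly_actZ poly_act_D poly_actC.
Qed.

Lemma poly_act_swap q r v :
  poly_act q (poly_act r v) = poly_act r (poly_act q v).
Proof. by rewrite -!poly_actM mulrC. Qed.

Lemma poly_act_suml (I : finType) (q_ : I -> {poly F}) v :
  poly_act (\sum_i q_ i) v = \sum_i poly_act (q_ i) v.
Proof.
apply: (big_morph (fun q => poly_act q v)) => [q r|]; first exact: poly_actD.
by rewrite -polyC0 poly_actC scale0r.
Qed.

Lemma poly_act_sumr (I : finType) q (v_ : I -> V) :
  poly_act q (\sum_i v_ i) = \sum_i poly_act q (v_ i).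
Proof. exact: linear_sum. Qed.

(** Identities between polynomials become identities between operators once
    the operators of the problem are recognised as actions of polynomials. *)
Lemma factor_opE a k v : factor_op D a k v = poly_act (('X + a%:P) ^+ k) v.
Proof.
elim: k => [|k IHk]; first by rewrite expr0 poly_act1.
rewrite exprS poly_actM -IHk poly_actD poly_actX poly_actC.
by rewrite /factor_op iterS.
Qed.

Lemma product_opE l (lam : 'I_l.+1 -> F) (p : 'I_l.+1 -> nat) v :
  product_op D lam p v = poly_act (\prod_i ('X + (lam i)%:P) ^+ p i) v.
Proof.
rewrite /product_op; elim/big_rec2: _ v => [|i q op _ IH] v /=.
  by rewrite poly_act1.
by rewrite poly_actM -IH factor_opE.
Qed.

End PolynomialAction.

Section PairwiseCoprime.
Variables (F : fieldType) (I : finType) (P : I -> {poly F}).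

Definition cofactor i : {poly F} := \prod_(j | j != i) P j.

Lemma prodE_cofactor i : \prod_j P j = P i * cofactor i.
Proof. exact: bigD1. Qed.

(** Both sides are the product of [P i], [P j] and the [P k], [k != i, j],
    with one of the first two removed. *)
Lemma cofactor_exchange i j : i != j ->
  exists2 q, cofactor i = q * P j & cofactor j = q * P i.
Proof.
move=> neq_ij; exists (\prod_(k | (k != i) && (k != j)) P k).
  by rewrite mulrC /cofactor (bigD1 j) // eq_sym.
rewrite mulrC /cofactor (bigD1 i) //=; congr (_ * _).
by apply: eq_bigl => k; rewrite andbC.
Qed.

Hypothesis coprime_P : forall i j, i != j -> coprimep (P i) (P j).

Lemma coprimep_cofactor i : coprimep (P i) (cofactor i).
Proof.
rewrite /cofactor; elim/big_rec: _ => [|j q neq_ji coq]; first exact: coprimep1.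
by rewrite coprimepMr coq andbT coprime_P // eq_sym.
Qed.

Lemma prod_dvdp_pairwise q : (forall i, P i %| q) -> \prod_i P i %| q.
Proof.
move=> dvdPq; have := index_enum_uniq I; elim: (index_enum I) => [|i r IHr] /=.
  by rewrite big_nil dvd1p.
case/andP=> i'r uniq_r; rewrite big_cons Gauss_dvdp ?dvdPq ?IHr //.
elim: r i'r {IHr uniq_r} => [|j r IHr]; first by rewrite big_nil coprimep1.
rewrite inE negb_or => /andP[neq_ij i'r].
by rewrite big_cons coprimepMr coprime_P ?IHr.
Qed.

(** Choosing [a i] with [a i * cofactor i = 1] modulo [P i] makes
    [\sum_i a i * cofactor i] congruent to [1] modulo every [P i], hence modulo
    their product.  This product being a multiple of [cofactor i0], the error is
    absorbed into the coefficient of index [i0]. *)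
Lemma exists_partition_of_unity (i0 : I) :
  exists c : I -> {poly F}, \sum_i c i * cofactor i = 1.
Proof.
have inv_mod i : exists a, P i %| a * cofactor i - 1.
  have /Bezout_eq1_coprimepP[[b a] /= ab1] := coprimep_cofactor i.
  by exists a; rewrite -ab1 opprD addrCA subrr addr0 -mulNr dvdp_mull.
have [a aP] := fin_all_exists inv_mod.
have /dvdpP[r def_r]: \prod_i P i %| \sum_i a i * cofactor i - 1.
  apply: prod_dvdp_pairwise => i; rewrite (bigD1 i) //= addrAC dvdp_addr //.
  apply: (big_ind (fun x => P i %| x)) =>
    [|x y|j neq_ji]; [exact: dvdp0 | exact: dvdp_add |].
  have [q -> _] := cofactor_exchange neq_ji.
  by rewrite mulrA dvdp_mull.
exists (fun i => if i == i0 then a i - r * P i else a i).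
rewrite (bigD1 i0) //= eqxx mulrBl -mulrA -prodE_cofactor -def_r.
under eq_bigr => i /negPf-> do [].
by rewrite addrAC [X in _ - (X - 1)](bigD1 i0) //= subKr.
Qed.

End PairwiseCoprime.

Lemma coprimep_XaddC_exp (F : fieldType) (a b : F) m n :
  a != b -> coprimep (('X + a%:P) ^+ m) (('X + b%:P) ^+ n).
Proof.
move=> neq_ab; apply/coprimep_expl/coprimep_expr.
rewrite -[a]opprK -[b]opprK (polyCN (- a)) (polyCN (- b)) coprimep_XsubC2 //.
by rewrite opprK addrC subr_eq0.
Qed.

Theorem theorem1p2 (F : fieldType) (V : lmodType F) (D : {linear V -> V})
    (D_nontrivial : exists v : V, D v != 0)
    (l : nat) (lam : 'I_l.+1 -> F) (lam_distinct : injective lam)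
    (p : 'I_l.+1 -> nat) (p_ge1 : forall i, (1 <= p i)%N)
    (f : V) :
  exists g : {u : V | product_sol D lam p f u} ->
             {us : {ffun 'I_l.+1 -> V} | system_sol D lam p f us},
    bijective g.
Proof.
pose P i : {poly F} := ('X + (lam i)%:P) ^+ p i.
have coP i j : i != j -> coprimep (P i) (P j).
  by move=> neq_ij; apply: coprimep_XaddC_exp; rewrite (inj_eq lam_distinct).
have [c c1] := exists_partition_of_unity coP ord0.
pose split_sol (u : V) : {ffun 'I_l.+1 -> V} :=
  [ffun i => poly_act D (cofactor P i) u].
pose merge_sol (us : {ffun 'I_l.+1 -> V}) : V :=
  \sum_i poly_act D (c i) (us i).
have productP u :
    reflect (poly_act D (\prod_i P i) u = f) (product_sol D lam p f u).
  by rewrite /product_sol product_opE; exact: eqP.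
have systemP (us : {ffun _ -> V}) :
    reflect (forall i, poly_act D (P i) (us i) = f) (system_sol D lam p f us).
  apply: (iffP forallP) => sol i; last by rewrite factor_opE; exact/eqP/sol.
  by rewrite -[RHS](eqP (sol i)) factor_opE.
have split_ok u : product_sol D lam p f u -> system_sol D lam p f (split_sol u).
  move=> /productP Pu; apply/systemP => i.
  by rewrite ffunE -poly_actM -prodE_cofactor.
have unity v : \sum_i poly_act D (c i) (poly_act D (cofactor P i) v) = v.
  under eq_bigr do rewrite -poly_actM.
  by rewrite -poly_act_suml c1 poly_act1.
have merge_ok us :
    system_sol D lam p f us -> product_sol D lam p f (merge_sol us).
  move=> /systemP sol; apply/productP; rewrite /merge_sol poly_act_sumr.
  rewrite -[RHS]unity; apply: eq_bigr => i _.
  by rewrite poly_act_swap (prodE_cofactor P i) mulrC poly_actM sol.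
(* Applying [cofactor P i] to [u_j] first applies [P j], giving [f], and this
   [f] is also the image of [u_i] under [P i]. *)
have cross us i j : system_sol D lam p f us ->
    poly_act D (cofactor P i) (us j) = poly_act D (cofactor P j) (us i).
  move=> /systemP sol; have [-> //|/(cofactor_exchange P)[q -> ->]] := eqVneq i j.
  by rewrite !poly_actM !sol.
exists (fun u => exist _ (split_sol (val u)) (split_ok _ (valP u))).
exists (fun us => exist _ (merge_sol (val us)) (merge_ok _ (valP us))).
  move=> u; apply: val_inj; rewrite /= -[RHS]unity.
  by apply: eq_bigr => i _; rewrite ffunE.
move=> us; apply: val_inj; apply/ffunP => i; rewrite ffunE /= -[RHS]unity.
rewrite /merge_sol poly_act_sumr; apply: eq_bigr => j _.
by rewrite poly_act_swap cross ?(valP us).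
Qed.
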